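(* Let $P=(X,\prec)$ be a finite poset, and let $A,B\subseteq X$ be nonempty subsets. Let $f$ be a uniformly random linear extension of $P$, and for $S\subseteq X$ nonempty let $f_{\min}(S):=\min\{f(s):s\in S\}$. Then $$\frac{\mathbb{E}\big[f_{\min}(A)\,f_{\min}(B)\big]+\mathbb{E}\big[f_{\min}(A\cup B)\big]}{\mathbb{E}\big[f_{\min}(A)\big]\cdot\mathbb{E}\big[f_{\min}(B)\big]}\ \le\ 2.$$
   Context: A linear extension of a poset $P=(X,\prec)$ with $|X|=n$ is a bijection $f:X\to\{1,\dots,n\}$ such that $u\prec v$ implies $f(u)<f(v)$. Expectations are with respect to the uniform distribution on the set of linear extensions of $P$. *)

(* Defs.v *)
From HB Require Import structures.
From mathcomp Require Import all_boot all_order all_algebra.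
Set Implicit Arguments.
Unset Strict Implicit.
Unset Printing Implicit Defensive.
Import Order.TTheory GRing.Theory Num.Theory.

Local Open Scope ring_scope.

(* A labelling f : X -> {1, ..., n}, n = #|X|, is encoded by its 0-based
   version X -> 'I_n; the label of x is (f x).+1. *)
Definition labelling d (X : finPOrderType d) := {ffun X -> 'I_#|X|}.

Definition label d (X : finPOrderType d) (f : labelling X) (x : X) : nat :=
  (f x).+1.

Definition is_linear_extension d (X : finPOrderType d) (f : labelling X) : bool :=
  [&& [forall u, forall v, (f u == f v) ==> (u == v)],
      [forall i, exists u, f u == i]
    & [forall u, forall v, (u < v)%O ==> (label f u < label f v)%N]].

Definition linear_extensions d (X : finPOrderType d) : {set labelling X} :=
  [set f | is_linear_extension f].

(* All labels are at most #|X|, so for nonempty S the neutral value #|X| does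
   not affect the minimum. *)
Definition fmin d (X : finPOrderType d) (S : {set X}) (f : labelling X) : nat :=
  \big[minn/#|X|]_(s in S) label f s.

(* Expectation under the uniform distribution on linear extensions. *)
Definition expect (R : realFieldType) d (X : finPOrderType d)
    (g : labelling X -> R) : R :=
  (\sum_(f in linear_extensions X) g f) / #|linear_extensions X|%:R.

(* Main.v *)
Require Import Defs.
From HB Require Import structures.
From mathcomp Require Import all_boot all_order all_algebra.
From mathcomp Require Import zify ring lra.
Set Implicit Arguments.
Unset Strict Implicit.
Unset Printing Implicit Defensive.
Import Order.TTheory GRing.Theory Num.Theory.
Local Open Scope ring_scope.

(* Write e(Q) for the number of linear extensions of Q. Add to the poset Q an
   element a whose only relations are a < y for y in A. Counting the slots where
   a can be inserted gives e(Q + a) = sum_f fmin A f; inserting both a (below A)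
   and b (below B) gives e(Q + a + b) = sum_f (fmin A f * fmin B f + fmin (A :|: B) f).
   So the theorem says e(Q + a + b) e(Q) <= 2 e(Q + a) e(Q + b). It is proved
   together with e(Q + a) e(Q + b) <= e(Q + a + b) e(Q) by induction on #|Q|,
   conditioning on the first element x of a linear extension. The lower bound
   for Q - x, applied to the new elements a and x, says that
   e(Q - x + a) / e(Q - x) <= e(Q + a) / e(Q), and this is the only input that
   the induction steps of both bounds need. *)

(** * Two inequalities for weighted sums, used in the induction steps *)

Section WeightedSums.

Variables (R : realFieldType) (I : finType) (P : {set I}).
(** In both uses [p x] counts the linear extensions of [Q] that start with [x], and [a x], [b x],
    [c x] count those of [Q] enlarged by a, by b and by both. [N], [al], [be] are the totals for
    [Q], [Q + a], [Q + b]; the summand [N] in [al_def] counts the extensions that start with a. *)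
Variables (p a b c : I -> R) (N al be : R).
Hypotheses (p_gt0 : forall x, x \in P -> 0 < p x) (N_gt0 : 0 < N).
Hypothesis sum_p : \sum_(x in P) p x = N.
Hypothesis al_def : al = N + \sum_(x in P) a x.
Hypothesis be_def : be = N + \sum_(x in P) b x.
Hypothesis a_le : forall x, x \in P -> a x * N <= al * p x.
Hypothesis b_le : forall x, x \in P -> b x * N <= be * p x.

(* Covariance bound: with u = a / p - E[a / p] and v = b / p - E[b / p] for the
   probability p / N, the hypotheses say u, v <= 1, so E[(1 - u) (1 - v)] >= 0
   gives Cov >= -1. *)
Lemma covariance_lower_bound :
  (forall x, x \in P -> a x * b x <= c x * p x) ->
  al * be <= (al + be + \sum_(x in P) c x) * N.
Proof.
move=> abc.
have term x : x \in P ->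
    N * (be * a x + al * b x) <= N ^+ 2 * c x + al * be * p x.
  move=> xP; have p0 := p_gt0 xP.
  rewrite -(ler_pM2r p0) -subr_ge0.
  have h1 : 0 <= (al * p x - a x * N) * (be * p x - b x * N).
    by apply: mulr_ge0; rewrite subr_ge0 ?a_le ?b_le.
  have h2 : 0 <= N ^+ 2 * (c x * p x - a x * b x).
    by apply: (mulr_ge0 (sqr_ge0 N)); rewrite subr_ge0 abc.
  by have := addr_ge0 h1 h2; congr (0 <= _); ring.
have := ler_sum (index_enum I) term.
rewrite -mulr_sumr !big_split /= -!mulr_sumr sum_p.
have -> : \sum_(x in P) a x = al - N by rewrite al_def; ring.
have -> : \sum_(x in P) b x = be - N by rewrite be_def; ring.
by move=> h; rewrite -(ler_pM2l N_gt0); lra.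
Qed.

(** Of the two copies of [a x * b x] that bound [c x * p x], [b_le] controls one by
    [be * a x * p x / N] and [a_le] the other by [al * b x * p x / N]. Cancelling [p x] and summing
    gives the claim. *)
Lemma covariance_upper_bound :
  (forall x, x \in P -> 0 <= a x) -> (forall x, x \in P -> 0 <= b x) ->
  (forall x, x \in P -> c x * p x <= 2 * (a x * b x)) ->
  (al + be + \sum_(x in P) c x) * N <= 2 * (al * be).
Proof.
move=> a0 b0 abc.
have term x : x \in P -> N * c x <= be * a x + al * b x.
  move=> xP; have p0 := p_gt0 xP.
  rewrite -(ler_pM2r p0) -subr_ge0.
  have h1 : 0 <= N * (2 * (a x * b x) - c x * p x).
    by apply: (mulr_ge0 (ltW N_gt0)); rewrite subr_ge0 abc.
  have h2 : 0 <= a x * (be * p x - b x * N).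
    by apply: (mulr_ge0 (a0 x xP)); rewrite subr_ge0 b_le.
  have h3 : 0 <= b x * (al * p x - a x * N).
    by apply: (mulr_ge0 (b0 x xP)); rewrite subr_ge0 a_le.
  by have := addr_ge0 (addr_ge0 h1 h2) h3; congr (0 <= _); ring.
have := ler_sum (index_enum I) term.
rewrite -mulr_sumr big_split /= -!mulr_sumr.
have -> : \sum_(x in P) a x = al - N by rewrite al_def; ring.
have -> : \sum_(x in P) b x = be - N by rewrite be_def; ring.
by move=> h; lra.
Qed.

End WeightedSums.

(** * Linear extensions as lists, built by choosing a minimal element first *)

Section LinearExtensionLists.

Local Open Scope nat_scope.

Variables (T : finType) (r : rel T).
Implicit Types (S Q : {set T}) (s : seq T) (a b x : T).

Definition minimals S : {set T} :=
  [set x in S | [forall y in S, ~~ r y x]].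

(** [n] is fuel for the recursion on [S :\ x]; [lin_lists] supplies exactly [#|S|]. *)
Fixpoint lin_lists_rec (n : nat) (S : {set T}) : seq (seq T) :=
  if n is m.+1 then
    [seq x :: s | x <- enum (minimals S), s <- lin_lists_rec m (S :\ x)]
  else [:: [::]].

Definition lin_lists (S : {set T}) := lin_lists_rec #|S| S.

Definition num_ext (S : {set T}) := size (lin_lists S).

Lemma minimalsP S x :
  reflect (x \in S /\ forall y, y \in S -> ~~ r y x) (x \in minimals S).
Proof.
rewrite inE; apply: (iffP andP) => -[xS].
  by move/forall_inP.
by move=> h; split => //; apply/forall_inP.
Qed.

Lemma minimals_sub S x : x \in minimals S -> x \in S.
Proof. by case/minimalsP. Qed.

Lemma lin_lists0 : lin_lists set0 = [:: [::]].
Proof. by rewrite /lin_lists cards0. Qed.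

Lemma lin_listsE S : S != set0 ->
  lin_lists S = [seq x :: s | x <- enum (minimals S), s <- lin_lists (S :\ x)].
Proof.
move=> S0; rewrite /lin_lists; case E: #|S| => [|m] /=.
  by move/eqP: E; rewrite cards_eq0 (negPf S0).
apply/congr1/eq_in_map => x; rewrite mem_enum => /minimals_sub xS.
by have := cardsD1 x S; rewrite xS E add1n => -[->].
Qed.

Lemma num_ext0 : num_ext set0 = 1.
Proof. by rewrite /num_ext lin_lists0. Qed.

Lemma sum_lin_lists S (F : seq T -> nat) : S != set0 ->
  \sum_(s <- lin_lists S) F s =
  \sum_(x in minimals S) \sum_(s <- lin_lists (S :\ x)) F (x :: s).
Proof. by move=> S0; rewrite lin_listsE // big_allpairs_dep big_enum. Qed.

Lemma num_extE S : S != set0 ->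
  num_ext S = \sum_(x in minimals S) num_ext (S :\ x).
Proof.
move=> S0; rewrite /num_ext -sum1_size sum_lin_lists //.
by apply: eq_bigr => x _; rewrite sum1_size.
Qed.

Lemma lin_lists_uniq S : uniq (lin_lists S).
Proof.
rewrite /lin_lists; move: #|S| => n; elim: n S => //= m IH S.
apply: allpairs_uniq_dep => [|x _|]; rewrite ?enum_uniq ?IH //.
by move=> [x s] [y t] _ _ /= [-> ->].
Qed.

(** * Inserting new elements that have nothing below them *)

Definition minimal_over a Q :=
  a \notin Q /\ forall y, y \in a |: Q -> ~~ r y a.

Lemma minimal_overD1 a Q x : minimal_over a Q -> minimal_over a (Q :\ x).
Proof.
case=> aQ min_a; split; first by rewrite in_setD1 (negPf aQ) andbF.
by move=> y /setU1P[->|/setD1P[_ yQ]]; apply: min_a; rewrite !inE ?eqxx ?yQ ?orbT.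
Qed.

Lemma minimal_overU1 a b Q : minimal_over a (b |: Q) -> minimal_over a Q.
Proof.
case; rewrite in_setU1 negb_or => /andP[_ aQ] min_a; split => // y.
by move=> /setU1P[->|yQ]; apply: min_a; rewrite !inE ?eqxx ?yQ ?orbT.
Qed.

Lemma sum_minimalsU1 a Q (F : T -> nat) : minimal_over a Q ->
  \sum_(x in minimals (a |: Q)) F x =
  F a + \sum_(x in minimals Q) (if r a x then 0 else F x).
Proof.
case=> aQ min_a; rewrite (bigD1 a) /=; last first.
  by apply/minimalsP; split; rewrite ?setU11.
congr (_ + _); under [RHS]eq_bigr do rewrite -if_neg.
rewrite -big_mkcondr; apply: eq_bigl => x.
apply/andP/andP => -[/minimalsP[xQ hx] h].
  move: xQ; rewrite in_setU1 (negPf h) /= => xQ.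
  split; last by apply: hx; rewrite setU11.
  by apply/minimalsP; split => // y yQ; apply: hx; rewrite setU1r.
split; last by apply: contraNneq aQ => <-.
by apply/minimalsP; split; rewrite ?setU1r // => y /setU1P[->|/hx].
Qed.

Lemma setU1_neq0 a Q : a |: Q != set0.
Proof. by apply/set0Pn; exists a; rewrite setU11. Qed.

Lemma setU1D1 a Q x : a != x -> (a |: Q) :\ x = a |: (Q :\ x).
Proof.
move=> ax; apply/setP => y; rewrite !inE.
by case: (eqVneq y a) => [->|]; rewrite ?ax //=.
Qed.

Lemma minimal_overD1_U1 a b Q x : x \in Q ->
  minimal_over b Q -> minimal_over a (b |: Q) -> minimal_over a (b |: (Q :\ x)).
Proof.
move=> xQ [bQ _] /(minimal_overD1 x); rewrite setU1D1 //.
by apply: contraNneq bQ => ->.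
Qed.

Lemma num_extU1 a Q : minimal_over a Q ->
  num_ext (a |: Q) =
  num_ext Q + \sum_(x in minimals Q) (if r a x then 0 else num_ext (a |: (Q :\ x))).
Proof.
move=> aQ; rewrite num_extE ?setU1_neq0 // sum_minimalsU1 //.
rewrite setU1K ?(proj1 aQ) //; congr (_ + _); apply: eq_bigr => x /minimals_sub xQ.
by rewrite setU1D1 //; apply: contraNneq (proj1 aQ) => ->.
Qed.

(** An extension starts with [b], with [a], or with a minimal element of [Q] that is above
    neither. *)
Lemma num_extU2 a b Q : minimal_over a (b |: Q) -> minimal_over b (a |: Q) ->
  num_ext (a |: (b |: Q)) =
  num_ext (a |: Q) + num_ext (b |: Q) +
  \sum_(x in minimals Q)
     (if r a x then 0 else if r b x then 0 else num_ext (a |: (b |: (Q :\ x)))).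
Proof.
move=> aQ bQ.
have a_b : a != b by case: aQ; rewrite in_setU1 negb_or => /andP[].
have rab : r a b = false by apply/negbTE; case: bQ => _; apply; rewrite !inE eqxx orbT.
have b_Q : minimal_over b Q by exact: minimal_overU1 bQ.
rewrite num_extU1 // sum_minimalsU1 // rab setU1K ?(proj1 b_Q) //.
rewrite addnA [num_ext (b |: Q) + _]addnC; congr (_ + _); apply: eq_bigr => x /minimals_sub xQ.
case: (r a x); case: (r b x) => //; rewrite setU1D1 //.
by apply: contraNneq (proj1 b_Q) => ->.
Qed.

(** If [k] entries of [s] precede the first one above [a], then [a] fits into [k.+1] slots; [find]
    returns the length when no entry is above [a], which is again right. The induction compares both
    sides by first element. *)
Lemma sum_find a Q : minimal_over a Q ->
  \sum_(s <- lin_lists Q) (find (r a) s).+1 = num_ext (a |: Q).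
Proof.
have [n] := ubnP #|Q|; elim: n Q => // n IH Q ltn aQ; rewrite num_extU1 //.
have [->|Q0] := eqVneq Q set0.
  rewrite lin_lists0 big_seq1 num_ext0 big1 // => x /minimals_sub.
  by rewrite inE.
rewrite sum_lin_lists // num_extE // -big_split; apply: eq_bigr => x xQ /=.
have ltQ : #|Q :\ x| < n.
  by rewrite -ltnS; apply: leq_trans ltn;
    rewrite ltnS [leqRHS](cardsD1 x) (minimals_sub xQ).
case: (r a x); first by rewrite addn0 sum1_size.
rewrite -IH //; last exact: minimal_overD1.
by rewrite /num_ext -sum1_size -big_split; apply: eq_bigr => s _.
Qed.

(** The product counts pairs of slots. When both new elements choose the same slot they can be
    ordered in two ways; the slots open to both are those up to the first entry above [a] or [b],
    whence the extra term. *)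
Lemma sum_findM a b Q : minimal_over a (b |: Q) -> minimal_over b (a |: Q) ->
  \sum_(s <- lin_lists Q)
     ((find (r a) s).+1 * (find (r b) s).+1 + (find (predU (r a) (r b)) s).+1) =
  num_ext (a |: (b |: Q)).
Proof.
have [n] := ubnP #|Q|; elim: n Q => // n IH Q ltn aQ bQ; rewrite num_extU2 //.
have a_Q : minimal_over a Q by exact: minimal_overU1 aQ.
have b_Q : minimal_over b Q by exact: minimal_overU1 bQ.
rewrite -!sum_find //.
have [->|Q0] := eqVneq Q set0.
  rewrite lin_lists0 !big_seq1 big1 ?addn0 // => x /minimals_sub.
  by rewrite inE.
rewrite !sum_lin_lists // -!big_split; apply: eq_bigr => x xQ /=.
have ltQ : #|Q :\ x| < n.
  by rewrite -ltnS; apply: leq_trans ltn;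
    rewrite ltnS [leqRHS](cardsD1 x) (minimals_sub xQ).
have xQ' := minimals_sub xQ.
rewrite -(IH _ ltQ (minimal_overD1_U1 xQ' b_Q aQ) (minimal_overD1_U1 xQ' a_Q bQ)).
case: (r a x); case: (r b x) => /=; rewrite ?addn0 -!big_split;
  by apply: eq_bigr => s _ /=; lia.
Qed.

(** * Positivity and membership for acyclic relations *)

Hypothesis acyclic : exists h : T -> nat, forall x y, r x y -> h x < h y.

Lemma minimals_neq0 S : S != set0 -> minimals S != set0.
Proof.
case: acyclic => h hr /set0Pn[x xS]; case: (arg_minnP h xS) => z zS min_z.
apply/set0Pn; exists z; apply/minimalsP; split => // y yS.
by apply/negP => /hr; rewrite ltnNge min_z.
Qed.

Lemma num_ext_gt0 S : 0 < num_ext S.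
Proof.
have [n] := ubnP #|S|; elim: n S => // n IH S ltn.
have [->|S0] := eqVneq S set0; first by rewrite num_ext0.
rewrite num_extE //; case/set0Pn: (minimals_neq0 S0) => x xS.
rewrite (bigD1 x) //= ltn_addr // IH //.
by rewrite -ltnS; apply: leq_trans ltn; rewrite ltnS [leqRHS](cardsD1 x) (minimals_sub xS).
Qed.

Lemma mem_lin_lists S s :
  (s \in lin_lists S) =
  [&& uniq s, [set x in s] == S & pairwise (fun x y => ~~ r y x) s].
Proof.
elim: s S => [|x s IH] S.
  have -> : [set x in [::] : seq T] = set0 by apply/setP => y; rewrite !inE.
  rewrite /= andbT eq_sym; have [->|S0] := eqVneq S set0; first by rewrite lin_lists0.
  by rewrite lin_listsE //; apply/negbTE/negP => /allpairsPdep[? [? []]].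
have [->|S0] := eqVneq S set0.
  rewrite lin_lists0 mem_seq1; apply/esym/negbTE; rewrite !negb_and; apply/orP; right.
  by apply/orP; left; apply/set0Pn; exists x; rewrite inE mem_head.
rewrite lin_listsE //=; apply/allpairsPdep/and3P.
  move=> [y [t [yS tS [Ex Es]]]]; move: yS tS.
  rewrite -Ex -Es mem_enum => /minimalsP[xS min_x].
  rewrite IH => /and3P[uniq_s /eqP s_S pair_s].
  have sE z : (z \in s) = (z != x) && (z \in S).
    by move/setP/(_ z): s_S; rewrite !inE.
  split; first by rewrite uniq_s sE eqxx.
    apply/eqP/setP => z; rewrite !inE sE.
    by case: (eqVneq z x) => [->|].
  by rewrite pair_s andbT; apply/allP => z; rewrite sE => /andP[_ /min_x].
move=> [/andP[xs uniq_s] /eqP defS /andP[/allP min_x pair_s]].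
exists x, s; split => //.
  rewrite mem_enum; apply/minimalsP; rewrite -defS inE mem_head; split => // y.
  rewrite inE in_cons => /orP[/eqP->|/min_x //].
  by case: acyclic => h hr; apply/negP => /hr; rewrite ltnn.
rewrite IH uniq_s pair_s andbT; apply/eqP/setP => z; rewrite -defS !inE.
by case: (eqVneq z x) => [->|] //=; apply/negbTE.
Qed.

(** * The lower and upper bounds for two inserted elements *)

Definition ext_covariance a b Q :=
  num_ext (a |: Q) * num_ext (b |: Q) <= num_ext (a |: (b |: Q)) * num_ext Q.

(** Lets a minimal element [x] of [Q] act as the second inserted element over [Q :\ x]. *)
Lemma minimal_over_minimals a Q x :
  minimal_over a Q -> x \in minimals Q -> r a x = false ->
  minimal_over a (x |: (Q :\ x)) /\ minimal_over x (a |: (Q :\ x)).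
Proof.
move=> aQ /minimalsP[xQ min_x] rax; rewrite setD1K //; split => //; split.
  rewrite !inE eqxx /= orbF eq_sym; apply: contraNneq (proj1 aQ) => -> //.
move=> y /setU1P[->|/setU1P[->|/setD1P[_ /min_x]]] //; first exact: min_x.
by rewrite rax.
Qed.

(* Removing a minimal element x from Q does not increase the ratio
   num_ext (a |: Q) / num_ext Q, the mean first position of the set r a. *)
Lemma num_ext_ratio a Q x :
  minimal_over a Q -> x \in minimals Q ->
  (r a x = false -> ext_covariance a x (Q :\ x)) ->
  (if r a x then 0 else num_ext (a |: (Q :\ x))) * num_ext Q
    <= num_ext (a |: Q) * num_ext (Q :\ x).
Proof.
move=> aQ xQ; case: (r a x) => [_|/(_ erefl)]; first by rewrite mul0n.
by rewrite /ext_covariance (setD1K (minimals_sub xQ)).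
Qed.

(** By [sum_find] and [sum_findM], this bounds the covariance of the first positions of [r a] and
    [r b] below by minus the mean first position of their union. The induction generalizes [a] and
    [b], because the ratio bounds use the pairs [a], [x] and [b], [x] over [Q :\ x]. *)
Lemma num_ext_covariance a b Q :
  minimal_over a (b |: Q) -> minimal_over b (a |: Q) -> ext_covariance a b Q.
Proof.
have [n] := ubnP #|Q|; elim: n a b Q => // n IH a b Q ltn aQ bQ.
have a_Q : minimal_over a Q by exact: minimal_overU1 aQ.
have b_Q : minimal_over b Q by exact: minimal_overU1 bQ.
rewrite /ext_covariance num_extU2 //.
have [E|Q0] := eqVneq Q set0.
  rewrite !num_extU1 // E num_ext0.
  by rewrite !big1 // => x /minimals_sub; rewrite inE.
have ltQ x : x \in minimals Q -> #|Q :\ x| < n.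
  move=> xQ.
  by rewrite -ltnS; apply: leq_trans ltn;
    rewrite ltnS [leqRHS](cardsD1 x) (minimals_sub xQ).
have ratio c x : minimal_over c Q -> x \in minimals Q -> _ := fun cQ xQ =>
  num_ext_ratio cQ xQ (fun rcx => let: conj h1 h2 := minimal_over_minimals cQ xQ rcx in
    IH _ _ _ (ltQ x xQ) h1 h2).
(* The weighted inequality subtracts, so the counts are moved to a field. *)
rewrite -(ler_nat rat) !natrM 2!natrD natr_sum.
apply: (covariance_lower_bound (p := fun x => (num_ext (Q :\ x))%:R)
  (a := fun x => (if r a x then 0 else num_ext (a |: (Q :\ x)))%:R)
  (b := fun x => (if r b x then 0 else num_ext (b |: (Q :\ x)))%:R)).
- by move=> x _; rewrite ltr0n num_ext_gt0.
- by rewrite ltr0n num_ext_gt0.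
- by rewrite -natr_sum -num_extE.
- by rewrite -natr_sum -natrD -num_extU1.
- by rewrite -natr_sum -natrD -num_extU1.
- by move=> x xQ; rewrite -!natrM ler_nat ratio.
- by move=> x xQ; rewrite -!natrM ler_nat ratio.
move=> x xQ; rewrite -!natrM ler_nat; have xQ' := minimals_sub xQ.
case: (r a x); case: (r b x); rewrite ?muln0 ?mul0n //.
by apply: IH; rewrite ?ltQ //; apply: minimal_overD1_U1.
Qed.

(** The ratio bounds now come from [num_ext_covariance], so this induction keeps [a] and [b]
    fixed. *)
Lemma num_ext_covariance_le2 a b Q :
  minimal_over a (b |: Q) -> minimal_over b (a |: Q) ->
  num_ext (a |: (b |: Q)) * num_ext Q <= 2 * (num_ext (a |: Q) * num_ext (b |: Q)).
Proof.
have [n] := ubnP #|Q|; elim: n Q => // n IH Q ltn aQ bQ.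
have a_Q : minimal_over a Q by exact: minimal_overU1 aQ.
have b_Q : minimal_over b Q by exact: minimal_overU1 bQ.
rewrite num_extU2 //.
(* The empty case is an equality: [a] and [b] alone have two orders, which is where the constant 2
   is attained. *)
have [E|Q0] := eqVneq Q set0.
  rewrite !num_extU1 // E num_ext0.
  by rewrite !big1 // => x /minimals_sub; rewrite inE.
have ratio c x : minimal_over c Q -> x \in minimals Q -> _ := fun cQ xQ =>
  num_ext_ratio cQ xQ (fun rcx => let: conj h1 h2 := minimal_over_minimals cQ xQ rcx in
    num_ext_covariance h1 h2).
rewrite -(ler_nat rat) !natrM 2!natrD natr_sum.
apply: (covariance_upper_bound (p := fun x => (num_ext (Q :\ x))%:R)
  (a := fun x => (if r a x then 0 else num_ext (a |: (Q :\ x)))%:R)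
  (b := fun x => (if r b x then 0 else num_ext (b |: (Q :\ x)))%:R)).
- by move=> x _; rewrite ltr0n num_ext_gt0.
- by rewrite ltr0n num_ext_gt0.
- by rewrite -natr_sum -natrD -num_extU1.
- by rewrite -natr_sum -natrD -num_extU1.
- by move=> x xQ; rewrite -!natrM ler_nat ratio.
- by move=> x xQ; rewrite -!natrM ler_nat ratio.
- by move=> x _; rewrite ler0n.
- by move=> x _; rewrite ler0n.
move=> x xQ; rewrite -!natrM ler_nat; have xQ' := minimals_sub xQ.
case: (r a x); case: (r b x); rewrite ?muln0 ?mul0n //.
apply: IH; try exact: minimal_overD1_U1.
by rewrite -ltnS; apply: leq_trans ltn; rewrite ltnS [leqRHS](cardsD1 x) xQ'.
Qed.

End LinearExtensionLists.

(** * From labellings of a poset to lists *)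

Section Labellings.

Local Open Scope nat_scope.

Variables (d : Order.disp_t) (X : finPOrderType d) (A B : {set X}).
Implicit Types (f : labelling X) (x y : X) (S : {set X}).

(* The order of X with two new elements: [inr true] directly below the elements
   of A and [inr false] directly below those of B. *)
Definition ext_rel : rel (X + bool) := fun u v =>
  match u, v with
  | inl x, inl y => (x < y)%O
  | inr c, inl y => y \in if c then A else B
  | _, _ => false
  end.

Definition ground : {set X + bool} := [set inl x | x in X].

Definition list_of f : seq X := sort (fun x y => f x <= f y) (enum X).

Lemma linear_extensionP f :
  reflect [/\ injective f, (forall i, exists x, f x = i)
            & forall x y, (x < y)%O -> f x < f y]
          (f \in linear_extensions X).
Proof.
rewrite inE; apply: (iffP and3P) => [[fI fS fM]|[fI fS fM]]; split.
- by move=> x y /eqP E; apply/eqP; move/forallP/(_ x)/forallP/(_ y)/implyP: fI; apply.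
- by move=> i; move/forallP/(_ i)/existsP: fS => [x /eqP]; exists x.
- by move=> x y; move/forallP/(_ x)/forallP/(_ y)/implyP: fM.
- by apply/forallP => x; apply/forallP => y; apply/implyP => /eqP/fI->.
- by apply/forallP => i; case: (fS i) => x <-; apply/existsP; exists x.
- by apply/forallP => x; apply/forallP => y; apply/implyP => /fM.
Qed.

Lemma ext_rel_acyclic : exists h : X + bool -> nat, forall u v, ext_rel u v -> h u < h v.
Proof.
(* The successor puts the new elements strictly below all of [X]. *)
exists (fun u => if u is inl x then #|[set y | (y < x)%O]|.+1 else 0).
move=> [x|c] [y|c'] //= xy; rewrite ltnS; apply: proper_card.
apply/properP; split; last by exists x; rewrite !inE ?ltxx.
by apply/subsetP => z; rewrite !inE => /lt_trans; apply.
Qed.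

Lemma minimal_over_inr c (Q : {set X + bool}) :
  inr c \notin Q -> minimal_over ext_rel (inr c) Q.
Proof. by move=> cQ; split => // -[]. Qed.

Lemma inr_ground c : inr c \notin ground.
Proof. by apply/imsetP => -[]. Qed.

Lemma list_of_perm f : perm_eq (list_of f) (enum X).
Proof. by rewrite perm_sort. Qed.

Lemma mem_list_of f x : x \in list_of f.
Proof. by rewrite (perm_mem (list_of_perm f)) mem_enum. Qed.

Lemma list_of_uniq f : uniq (list_of f).
Proof. by rewrite (perm_uniq (list_of_perm f)) enum_uniq. Qed.

Lemma list_of_sorted f : sorted (fun x y => f x <= f y) (list_of f).
Proof. by apply: sort_sorted => x y; apply: leq_total. Qed.

(** Read along the list, the labels are sorted, distinct and fill all values below [#|X|], so they
    form [iota 0 #|X|]. *)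
Lemma index_list_of f x : injective f -> index x (list_of f) = f x.
Proof.
move=> fI; pose g y : nat := f y.
have gI : injective g by move=> y z /val_inj/fI.
have gE : map g (list_of f) = iota 0 #|X|.
  apply: (sorted_eq leq_trans anti_leq); last 1 first.
  - apply: uniq_perm; rewrite ?iota_uniq ?(map_inj_uniq gI) ?list_of_uniq //.
    apply: (uniq_min_size _ _ _).2.
    + by rewrite (map_inj_uniq gI) list_of_uniq.
    + by move=> _ /mapP[y _ ->]; rewrite mem_iota ltn_ord.
    + by rewrite size_iota size_map (perm_size (list_of_perm f)) -cardE.
  - by rewrite sorted_map; apply: list_of_sorted.
  exact: iota_sorted.
rewrite -(index_map gI) gE -[in LHS](add0n (g x)).
rewrite -(nth_iota 0 0 (ltn_ord (f x))) index_uniq ?size_iota ?iota_uniq //.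
Qed.

Lemma nth_list_of f x0 x : injective f -> nth x0 (list_of f) (f x) = x.
Proof. by move=> fI; rewrite -index_list_of // nth_index ?mem_list_of. Qed.

Lemma fmin_le S f x : x \in S -> fmin S f <= label f x.
Proof.
rewrite /fmin => xS; have: x \in index_enum X by rewrite mem_index_enum.
elim: (index_enum X) => // y l IH; rewrite in_cons big_cons => /orP[/eqP<-|/IH le_l].
  by rewrite xS geq_minl.
by case: ifP => // _; rewrite geq_min le_l orbT.
Qed.

Lemma fmin_find S f : injective f -> S != set0 ->
  fmin S f = (find (mem S) (list_of f)).+1.
Proof.
move=> fI /set0Pn[x0 x0S]; set s := list_of f.
have hasS : has (mem S) s by apply/hasP; exists x0; rewrite ?mem_list_of.
apply/eqP; rewrite eqn_leq; apply/andP; split.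
  apply: leq_trans (fmin_le f (nth_find x0 hasS)) _.
  by rewrite /label ltnS -index_list_of // index_uniq ?list_of_uniq // -has_find.
rewrite /fmin; elim/big_ind: _ => [|u v hu hv|x xS].
(* The neutral value [#|X|] is harmless: [S] is nonempty, so [find] stays below the length. *)
- by rewrite cardE -(perm_size (list_of_perm f)) -/s -has_find.
- by rewrite leq_min hu.
rewrite /label ltnS leqNgt; apply/negP => /(before_find x0).
by rewrite nth_list_of //= xS.
Qed.

Definition lift_list f : seq (X + bool) := map inl (list_of f).

Lemma inl_inj : injective (@inl X bool).
Proof. by move=> x y []. Qed.

Lemma lift_list_mem f : f \in linear_extensions X ->
  lift_list f \in lin_lists ext_rel ground.
Proof.
case/linear_extensionP => fI _ fM.
rewrite mem_lin_lists; last exact: ext_rel_acyclic.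
apply/and3P; split.
- by rewrite (map_inj_uniq inl_inj) list_of_uniq.
- apply/eqP/setP => u; rewrite inE; apply/mapP/imsetP => -[x _ ->]; exists x => //.
  exact: mem_list_of.
rewrite pairwise_map; apply: sub_pairwise (_ : pairwise (fun x y => f x <= f y) _).
  by move=> x y /= fxy; apply/negP => /fM; rewrite ltnNge fxy.
rewrite -sorted_pairwise ?list_of_sorted // => y x z; exact: leq_trans.
Qed.

Lemma lift_list_inj : {in linear_extensions X &, injective lift_list}.
Proof.
move=> f g /linear_extensionP[fI _ _] /linear_extensionP[gI _ _].
move/(inj_map inl_inj) => E; apply/ffunP => x; apply/val_inj => /=.
by rewrite -!index_list_of // E.
Qed.

(** The preimage labels each element by its index in the list; sorting by that label gives the list
    back. *)
Lemma lift_list_surj s : s \in lin_lists ext_rel ground ->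
  exists2 f, f \in linear_extensions X & s = lift_list f.
Proof.
rewrite mem_lin_lists; last exact: ext_rel_acyclic.
case/and3P => uniq_s /eqP/setP s_ground pair_s.
have [t defs] : exists t, s = map inl t.
  have: {subset s <= ground} by move=> u; rewrite -s_ground inE.
  elim: (s) => [|u l IH] sub_l; first by exists [::].
  case: IH => [v vl|t ->]; first by apply: sub_l; rewrite in_cons vl orbT.
  by case/imsetP: (sub_l _ (mem_head _ _)) => x _ ->; exists (x :: t).
move: uniq_s s_ground pair_s; rewrite defs {s defs} (map_inj_uniq inl_inj) => uniq_t t_ground.
rewrite pairwise_map => pair_t.
have mem_t x : x \in t.
  by have := t_ground (inl x); rewrite inE (mem_map inl_inj) => ->; apply: imset_f.
have perm_t : perm_eq t (enum X).
  by apply: uniq_perm; rewrite ?enum_uniq // => x; rewrite mem_enum mem_t.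
have lt_index x : index x t < #|X| by rewrite cardE -(perm_size perm_t) index_mem.
pose f : labelling X := [ffun x => Ordinal (lt_index x)].
have fE x : f x = index x t :> nat by rewrite ffunE.
have fI : injective f.
  by move=> x y /(congr1 val) /=; rewrite !fE => /index_inj; apply.
exists f.
  apply/linear_extensionP; split => //.
    move=> i; have lt_i : i < size t by rewrite (perm_size perm_t) -cardE.
    case: t uniq_t lt_i {t_ground pair_t mem_t perm_t lt_index} f fE fI =>
      // x0 t uniq_t lt_i f fE _.
    by exists (nth x0 (x0 :: t) i); apply: val_inj; rewrite /= fE index_uniq.
  move=> x y xy; rewrite !fE ltnNge leq_eqVlt; apply/negP => /orP[/eqP/index_inj E|lt_yx].
    by move: xy; rewrite E ?ltxx.
  have /(pairwiseP x)/(_ (index y t) (index x t)) := pair_t.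
  by rewrite !inE !index_mem !nth_index // /= xy => /(_ (mem_t y) (mem_t x) lt_yx).
congr map; apply: (sorted_eq (leT := fun x y => f x <= f y)).
- by move=> y x z; apply: leq_trans.
- by move=> x y /anti_leq/val_inj/fI.
- rewrite sorted_pairwise; last by move=> y x z; apply: leq_trans.
  case Et: t => [|x0 t'] //; rewrite -Et.
  by apply/(pairwiseP x0) => i j; rewrite !inE => lti ltj ltij;
    rewrite !fE !index_uniq // ltnW.
- exact: list_of_sorted.
by rewrite perm_sym (permPl (list_of_perm f)) perm_sym.
Qed.

Lemma sum_linear_extensions (F : seq (X + bool) -> nat) :
  \sum_(f in linear_extensions X) F (lift_list f) =
  \sum_(s <- lin_lists ext_rel ground) F s.
Proof.
rewrite -big_enum -(big_map lift_list predT F) /=; apply: perm_big.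
apply: uniq_perm; rewrite ?lin_lists_uniq //.
  rewrite map_inj_in_uniq ?enum_uniq // => f g; rewrite !mem_enum.
  exact: lift_list_inj.
move=> s; apply/mapP/idP => [[f]|/lift_list_surj[f fL ->]].
  by rewrite mem_enum => fL ->; apply: lift_list_mem.
by exists f; rewrite ?mem_enum.
Qed.

Lemma find_lift_list c f : injective f -> (if c then A else B) != set0 ->
  (find (ext_rel (inr c)) (lift_list f)).+1 = fmin (if c then A else B) f.
Proof. by move=> fI S0; rewrite fmin_find // find_map. Qed.

End Labellings.

(** * Translating expectations into counts of extensions *)

Theorem theorem1p8 (R : realFieldType) (d : Order.disp_t)
    (X : finPOrderType d) (A B : {set X})
    (hA : A != set0) (hB : B != set0) :
  (expect (fun f : labelling X => (fmin A f)%:R * (fmin B f)%:R)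
     + expect (fun f : labelling X => (fmin (A :|: B) f)%:R))
  / (expect (fun f : labelling X => (fmin A f)%:R)
     * expect (fun f : labelling X => (fmin B f)%:R)) <= 2%:R :> R.
Proof.
set r := ext_rel A B; set Q := ground X.
pose a : X + bool := inr true; pose b : X + bool := inr false.
have aQ : minimal_over r a Q by apply/minimal_over_inr/inr_ground.
have bQ : minimal_over r b Q by apply/minimal_over_inr/inr_ground.
have abQ : minimal_over r a (b |: Q).
  by apply: minimal_over_inr; rewrite in_setU1 negb_or inr_ground.
have baQ : minimal_over r b (a |: Q).
  by apply: minimal_over_inr; rewrite in_setU1 negb_or inr_ground.
have acyclic := ext_rel_acyclic A B.
have linI (f : labelling X) : f \in linear_extensions X -> injective f.
  by case/linear_extensionP.
have N_E : #|linear_extensions X| = num_ext r Q.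
  by rewrite -sum1_card (sum_linear_extensions A B (fun=> 1)) sum1_size.
have sumA : (\sum_(f in linear_extensions X) fmin A f)%N = num_ext r (a |: Q).
  rewrite -sum_find // -sum_linear_extensions; apply: eq_bigr => f /linI fI.
  by rewrite (find_lift_list (c := true)).
have sumB : (\sum_(f in linear_extensions X) fmin B f)%N = num_ext r (b |: Q).
  rewrite -sum_find // -sum_linear_extensions; apply: eq_bigr => f /linI fI.
  by rewrite (find_lift_list (c := false)).
have sumAB : (\sum_(f in linear_extensions X)
    (fmin A f * fmin B f + fmin (A :|: B) f))%N = num_ext r (a |: (b |: Q)).
  rewrite -sum_findM // -sum_linear_extensions; apply: eq_bigr => f /linI fI.
  rewrite (find_lift_list (c := true)) // (find_lift_list (c := false)) //.
  rewrite (@fmin_find _ _ (A :|: B)) //; last first.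
    by case/set0Pn: hA => x xA; apply/set0Pn; exists x; rewrite inE xA.
  rewrite find_map; congr (_ + _.+1)%N; apply: eq_find => x /=.
  by rewrite in_setU.
rewrite /expect -mulrDl -big_split /=.
under [X in X / _ / _]eq_bigr do rewrite -natrM -natrD.
rewrite -!natr_sum sumAB sumA sumB N_E.
set K := num_ext r _; set M := num_ext r (a |: Q); set L := num_ext r (b |: Q).
set N := num_ext r Q.
have pos S : 0 < (num_ext r S)%:R :> R by rewrite ltr0n num_ext_gt0.
have [N0 M0 L0] : [/\ 0 < N%:R :> R, 0 < M%:R :> R & 0 < L%:R :> R] by split; apply: pos.
rewrite ler_pdivrMr; last by rewrite !mulr_gt0 ?invr_gt0.
(* Over the common denominator [N ^ 2], the claim becomes [K * N <= 2 * (M * L)] in [nat]. *)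
have -> : 2 * (M%:R / N%:R * (L%:R / N%:R)) = (2 * (M * L))%:R / N%:R ^+ 2 :> R.
  by rewrite !natrM; field; rewrite gt_eqF.
have -> : K%:R / N%:R = (K * N)%:R / N%:R ^+ 2 :> R.
  by rewrite !natrM; field; rewrite gt_eqF.
rewrite ler_pM2r ?invr_gt0 ?exprn_gt0 // ler_nat.
exact: num_ext_covariance_le2.
Qed.
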